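(* Let $a_1<a_2<a_3$ be positive integers with $\gcd(a_1,a_2,a_3)=1$, and let $S=\{c_1a_1+c_2a_2+c_3a_3 : c_1,c_2,c_3\in\mathbb{N}\}$ be the numerical semigroup they generate (the set $\{a_1,a_2,a_3\}$ is not assumed to be the minimal generating set of $S$). Put $g=\gcd(a_2-a_1,a_3-a_1)$, $m=(a_2-a_1)/g$ and $n=(a_3-a_1)/g$. Let $\alpha$ be the integer with $0\le\alpha<mn$ and $\alpha\equiv -a_1 \pmod{mn}$. Then $$\mathrm{d}_{\max}(S)=\begin{cases}\left\lceil \dfrac{a_1}{mn}\right\rceil, & \text{if } \alpha\in\langle m,n\rangle,\\[2ex] \left\lceil \dfrac{a_1}{mn}\right\rceil+1, & \text{otherwise.}\end{cases}$$
   Context: $\mathbb{N}$ denotes the nonnegative integers. A numerical semigroup $S$ is a subset of $\mathbb{N}$ closed under addition, containing $0$, with finite complement in $\mathbb{N}$. It has a unique minimal generating set $\{b_1<\dots<b_t\}$: the minimal elements of $S\setminus\{0\}$ for the partial order $u\preceq u'$ iff $u'-u\in S$. A factorization of $s\in S$ is a tuple $(c_1,\dots,c_t)\in\mathbb{N}^t$ with $s=c_1b_1+\dots+c_tb_t$, where $b_1<\dots<b_t$ are the minimal generators of $S$; its length is $c_1+\dots+c_t$. A factorization of $s$ is maximal if its length is the largest among all factorizations of $s$. $\mathrm{d}_{\max}(s;S)$ is the number of maximal factorizations of $s$, and $\mathrm{d}_{\max}(S)=\max_{s\in S}\mathrm{d}_{\max}(s;S)$ (this maximum is finite). For integers $m,n\ge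 1$, $\langle m,n\rangle=\{pm+qn : p,q\in\mathbb{N}\}$. *)

(* Defs.v *)
From mathcomp Require Import all_boot all_order all_algebra.
From mathcomp Require Import finmap.
From mathcomp Require Import boolp classical_sets functions cardinality.

Set Implicit Arguments.
Unset Strict Implicit.
Unset Printing Implicit Defensive.

Local Open Scope classical_set_scope.
Local Open Scope nat_scope.

Definition generated2 (m n : nat) : set nat :=
  [set s | exists p q, s = p * m + q * n].

Definition generated3 (a1 a2 a3 : nat) : set nat :=
  [set s | exists c1 c2 c3, s = c1 * a1 + c2 * a2 + c3 * a3].

(* The definitions below are meant for a numerical semigroup S. In that case
   all the sets passed to fset_set are finite (fset_set is empty on an infinite
   set), and the maximum in dmax exists. *)

(* u' - u is truncated, hence the explicit u <= u'. *)
Definition prec (S : set nat) (u u' : nat) : Prop := u <= u' /\ S (u' - u).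

Definition mingen_set (S : set nat) : set nat :=
  [set b | [/\ S b, b <> 0 &
    forall u, S u -> u <> 0 -> prec S u b -> u = b]].

Definition mingens (S : set nat) : seq nat :=
  sort leq (fset_set (mingen_set S)).

Definition embdim (S : set nat) : nat := size (mingens S).

Definition is_factorization (S : set nat) (s : nat)
    (c : (embdim S).-tuple nat) : Prop :=
  s = \sum_(i < embdim S) tnth c i * nth 0 (mingens S) i.

Arguments is_factorization : clear implicits.

Definition fact_length (t : nat) (c : t.-tuple nat) : nat :=
  \sum_(i < t) tnth c i.

Definition max_factorizations (S : set nat) (s : nat) :
    set ((embdim S).-tuple nat) :=
  [set c | is_factorization S s c /\
    forall c' : (embdim S).-tuple nat,
      is_factorization S s c' -> fact_length c' <= fact_length c].

Arguments max_factorizations : clear implicits.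

Definition dmax_elt (S : set nat) (s : nat) : nat :=
  #|` fset_set (max_factorizations S s)|.

(* The value is 0 if dmax_elt has no maximum on S. As 0 \in S has exactly one
   factorization, 0 is never the value of the maximum itself. *)
Definition dmax (S : set nat) : nat :=
  xget 0 [set d | (exists2 s, S s & dmax_elt S s = d) /\
                  forall s, S s -> dmax_elt S s <= d].

(* Main.v *)
Require Import Defs.
From mathcomp Require Import all_boot all_order all_algebra.
From mathcomp Require Import finmap zify ring.
From mathcomp Require Import boolp classical_sets functions cardinality.

(** Call a triple (c1, c2, c3) a factorization of s even when {a1, a2, a3} is
    not minimal. If a_i is not a minimal generator, it is a sum of at least two
    generators, so replacing a_i lengthens a factorization: the longest triples
    do not use a_i, and they are the maximal factorizations of s padded by
    zeros.

    A triple of length L has value L a1 + g w with w = c2 m + c3 n, and two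
    triples of the same length and value differ by a multiple of (n-m, -n, m).
    If s has k + 1 >= 2 longest triples, then w = k m n + r with r in <m, n>,
    and w - a1 is not in <m, n>: otherwise a representation w - a1 = p m + q n
    with p < n would give the triple (L + g - p - q, p, q) of length L + g.
    Write a1 = c m n - alpha. Since <m, n> contains every integer >= m n, this
    forces k <= c, and even k < c when alpha is in <m, n>.

    The bound is attained at w = k m n and L = k n, with k = c - 1 if alpha is
    in <m, n> and k = c otherwise. In the second case m n - alpha, and hence
    a1, is in <m, n>, so that w - i a1 in <m, n> for some i >= 1 would give
    alpha = w - a1 in <m, n>. *)

Set Implicit Arguments.
Unset Strict Implicit.
Unset Printing Implicit Defensive.

Import Order.TTheory GRing.Theory Num.Theory.
Local Open Scope classical_set_scope.
Local Open Scope nat_scope.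

(** * Semigroups generated by two coprime integers *)

Lemma generated2D m n x y :
  generated2 m n x -> generated2 m n y -> generated2 m n (x + y).
Proof.
by move=> [p [q ->]] [p' [q' ->]]; exists (p + p'), (q + q'); ring.
Qed.

Lemma generated2M m n k x : generated2 m n x -> generated2 m n (k * x).
Proof. by move=> [p [q ->]]; exists (k * p), (k * q); ring. Qed.

Lemma coprime_modn_mul m n x : 0 < n -> coprime m n ->
  exists2 p, p < n & p * m = x %[mod n].
Proof.
(* The Chinese remainder that is 0 modulo [m] and [x] modulo [n] is a multiple of [m]; its cofactor
   is then reduced modulo [n]. *)
move=> n_gt0 cop_mn; have /esym/eqP := chinese_modl cop_mn 0 x.
rewrite mod0n eq_sym => /dvdnP[p Ep].
exists (p %% n); first by rewrite ltn_mod.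
by rewrite modnMml -Ep chinese_modr.
Qed.

Lemma generated2_eq_mod m n x p : p * m = x %[mod n] -> p * m <= x ->
  generated2 m n x.
Proof.
move=> /esym/eqP + le_pm; rewrite eqn_mod_dvd // => /dvdnP [q Eq].
by exists p, q; lia.
Qed.

Lemma generated2_ge m n x : 0 < n -> coprime m n -> m * n <= x ->
  generated2 m n x.
Proof.
move=> n_gt0 cop_mn le_mn; have [p lt_pn Ep] := coprime_modn_mul x n_gt0 cop_mn.
by apply: (generated2_eq_mod Ep); nia.
Qed.

(** Take [p < n] with [p * m] congruent to [x] modulo [n]. Since [x] is a gap, [p * m > x], so
    [m * n - x = (n - p) * m + (p * m - x)], and the last term is a multiple of [n]. *)
Lemma generated2_compl m n x : 0 < n -> coprime m n -> x < m * n ->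
  ~ generated2 m n x -> generated2 m n (m * n - x).
Proof.
move=> n_gt0 cop_mn lt_x gap_x.
have [p lt_pn Ep] := coprime_modn_mul x n_gt0 cop_mn.
have lt_xp : x < p * m.
  by rewrite ltnNge; apply/negP => /(generated2_eq_mod Ep)/gap_x.
move/eqP: Ep; rewrite eqn_mod_dvd ?(ltnW lt_xp)// => /dvdnP [q Eq].
by exists (n - p), q; nia.
Qed.

(** * Longest triples of a given value, and counting in finite sets *)

Definition val3 (a1 a2 a3 : nat) (t : nat * nat * nat) : nat :=
  t.1.1 * a1 + t.1.2 * a2 + t.2 * a3.

Definition len3 (t : nat * nat * nat) : nat := t.1.1 + t.1.2 + t.2.

Definition max3 (a1 a2 a3 s : nat) : set (nat * nat * nat) :=
  [set t | val3 a1 a2 a3 t = s /\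
    forall t', val3 a1 a2 a3 t' = s -> len3 t' <= len3 t].

Lemma len3_le_val3 a1 a2 a3 t : 0 < a1 -> 0 < a2 -> 0 < a3 ->
  len3 t <= val3 a1 a2 a3 t.
Proof. by rewrite /len3 /val3; nia. Qed.

Lemma max3_finite a1 a2 a3 s : 0 < a1 -> 0 < a2 -> 0 < a3 ->
  finite_set (max3 a1 a2 a3 s).
Proof.
move=> a1_gt0 a2_gt0 a3_gt0.
apply: (@sub_finite_set _ _ ((`I_s.+1 `*` `I_s.+1) `*` `I_s.+1)); last first.
  by do 2?apply: finite_setX; apply: finite_II.
move=> [[x y] z] [Et _]; have := len3_le_val3 (x, y, z) a1_gt0 a2_gt0 a3_gt0.
by rewrite Et /len3 /=; split; [split |]; rewrite /=; lia.
Qed.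

Lemma max3_ex a1 a2 a3 s t : 0 < a1 -> 0 < a2 -> 0 < a3 ->
  val3 a1 a2 a3 t = s -> exists2 t', max3 a1 a2 a3 s t' & len3 t <= len3 t'.
Proof.
move=> a1_gt0 a2_gt0 a3_gt0 Et.
pose P l := `[< exists2 t', val3 a1 a2 a3 t' = s & len3 t' = l >].
have exP : exists l, P l by exists (len3 t); apply/asboolP; exists t.
have ubP l : P l -> l <= s.
  by move=> /asboolP[t' <- <-]; apply: len3_le_val3.
case: (ex_maxnP exP ubP) => l /asboolP[t' Et' El] max_l.
have le_t' t'' : val3 a1 a2 a3 t'' = s -> len3 t'' <= len3 t'.
  by move=> Et''; rewrite El; apply: max_l; apply/asboolP; exists t''.
by exists t' => //; apply: le_t'.
Qed.

Lemma card_fset_set_le (T : choiceType) (A : set T) (f : T -> nat) d :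
  finite_set A -> {in A &, injective f} -> (forall t, A t -> f t < d) ->
  #|` fset_set A| <= d.
Proof.
move=> finA f_inj f_lt; rewrite -(size_iota 0 d) -(size_map f).
apply: uniq_leq_size => [|_ /mapP[t + ->]].
  rewrite map_inj_in_uniq // => t t' /=; rewrite !in_fset_set // => At At'.
  exact: f_inj.
by rewrite in_fset_set // inE mem_iota => /f_lt.
Qed.

Lemma card_fset_set_ge (T : choiceType) (A : set T) (f : nat -> T) d :
  finite_set A -> injective f -> (forall j, j < d -> A (f j)) ->
  d <= #|` fset_set A|.
Proof.
move=> finA f_inj f_A; rewrite -{1}(size_iota 0 d) -(size_map f).
apply: uniq_leq_size => [|_ /mapP[j + ->]].
  by rewrite map_inj_uniq // iota_uniq.
by rewrite mem_iota in_fset_set // inE => /f_A.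
Qed.

(** * The largest number of longest triples *)

Section Arithmetic.

Variables a g m n : nat.
Hypotheses (a_gt0 : 0 < a) (g_gt0 : 0 < g) (m_gt0 : 0 < m) (lt_mn : m < n).
Hypotheses (cop_mn : coprime m n) (cop_ga : coprime g a).

Let max3 := max3 a (a + g * m) (a + g * n).

Lemma val3_diff t : val3 a (a + g * m) (a + g * n) t =
  len3 t * a + g * (t.1.2 * m + t.2 * n).
Proof. by rewrite /val3 /len3; ring. Qed.

Lemma max3_aligned s t0 t : max3 s t0 -> max3 s t -> t0.1.2 <= t.1.2 ->
  exists k, [/\ t.1.2 = t0.1.2 + k * n, t0.2 = t.2 + k * m & len3 t = len3 t0].
Proof.
move=> [Et0 max_t0] [Et max_t] le_t.
have El : len3 t = len3 t0 by apply/eqP; rewrite eqn_leq max_t // max_t0.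
move: Et; rewrite -Et0 !val3_diff El => /eqP.
rewrite eqn_add2l eqn_pmul2l // => /eqP Ew.
have n_gt0 : 0 < n by lia.
have Ed : (t.1.2 - t0.1.2) * m = (t0.2 - t.2) * n by rewrite !mulnBl; lia.
have : n %| t.1.2 - t0.1.2.
  by rewrite -(@Gauss_dvdl _ _ m) 1?coprime_sym // Ed dvdn_mull.
move=> /dvdnP[k Ek]; exists k.
have Ek' : k * m = t0.2 - t.2.
  by apply/eqP; rewrite -(eqn_pmul2r n_gt0) -Ed Ek; apply/eqP; ring.
by split=> //; nia.
Qed.

(* The hypothesis [n <= t.1.2] holds for one of any two longest triples; it
   makes room for the longer triple built from [p < n]. *)
Lemma max3_gap s t y : max3 s t -> n <= t.1.2 -> generated2 m n y ->
  t.1.2 * m + t.2 * n <> a + y.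
Proof.
move=> [Et max_t] le_n [p0 [q0 Ey]] Ew.
have n_gt0 : 0 < n by lia.
pose p := p0 %% n; pose q := q0 + p0 %/ n * m.
have {}Ey : y = p * m + q * n.
  by rewrite Ey {1}(divn_eq p0 n) /p /q; ring.
have lt_pn : p < n by rewrite ltn_mod.
(* For any [x] and [z], [n * (x + z) = x * m + z * n + (n - m) * x]. Both terms on the right are
   larger for [t] than for [(p, q)], by [p < n <= t.1.2]. Hence the subtraction in the longer triple
   below is not truncated. *)
have lt_L : p + q < len3 t.
  rewrite -(ltn_pmul2l n_gt0).
  have le_pq : n * (p + q) <= t.1.2 * m + t.2 * n + (n - m) * p.
    by rewrite Ew Ey; nia.
  have lt_p : (n - m) * p < (n - m) * n by rewrite ltn_pmul2l // subn_gt0.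
  have ge_t : n * (t.1.2 + t.2) >= t.1.2 * m + t.2 * n + (n - m) * n.
    have : (n - m) * n <= (n - m) * t.1.2 by rewrite leq_mul2l le_n orbT.
    have : m * t.1.2 <= n * t.1.2 by rewrite leq_mul2r (ltnW lt_mn) orbT.
    by rewrite (mulnBl n m t.1.2) mulnDr (mulnC _ m) (mulnC _ n); lia.
  have le_len : n * (t.1.2 + t.2) <= n * len3 t by rewrite leq_mul2l /len3; lia.
  by lia.
have := max_t (len3 t + g - (p + q), p, q).
rewrite -Et !val3_diff /=.
have -> : len3 (len3 t + g - (p + q), p, q) = len3 t + g.
  by rewrite {1}/len3 /=; lia.
by rewrite Ew Ey => /(_ ltac:(ring)); lia.
Qed.

Variables (alpha c : nat).
Hypotheses (lt_alpha : alpha < m * n) (def_c : a + alpha = c * (m * n)).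

(** Since [0 <= alpha < m * n], [c] is the ceiling of [a / (m * n)], and [d] is the claimed
    maximum. *)
Let d := if alpha \in generated2 m n then c else c.+1.

Lemma max3_spread s t p k : max3 s t -> 0 < k ->
  t.1.2 = p + k * n -> k < d.
Proof.
move=> Mt k_gt0 E2; have n_gt0 : 0 < n by lia.
have gap y := @max3_gap s t y Mt ltac:(nia).
pose r := p * m + t.2 * n.
have Gr : generated2 m n r by exists p, t.2.
have Ew : t.1.2 * m + t.2 * n = k * (m * n) + r by rewrite E2 /r; ring.
rewrite ltnNge; apply/negP => le_dk.
have le_ck : c <= k by move: le_dk; rewrite /d; case: ifP; lia.
apply: (gap ((k - c) * (m * n) + alpha + r)); last by rewrite Ew; nia.
apply: generated2D Gr; move: le_dk; rewrite /d; case: ifPn => [|_ lt_ck].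
  rewrite inE => Galpha _; apply: generated2D Galpha.
  by exists ((k - c) * n), 0; ring.
by apply: generated2_ge => //; nia.
Qed.

Lemma dmax_bound_gt0 : 0 < d.
Proof. by rewrite /d; case: ifP => // _; nia. Qed.

(** Count from the longest triple [t0] with least second coordinate. Every longest triple lies [k]
    steps of [max3_aligned] away from [t0], is determined by [k], and has [k < d] by [max3_spread]
    when [k > 0]. *)
Lemma card_max3_le s : #|` fset_set (max3 s)| <= d.
Proof.
have fin : finite_set (max3 s)
  by apply: max3_finite; rewrite ?addn_gt0 ?a_gt0.
have [[t1 Mt1]|no] := pselect (exists t, max3 s t); last first.
  apply: (@card_fset_set_le _ _ (fun=> 0)) => //.
    by move=> t u; rewrite inE => Mt; case: no; exists t.
  by move=> t Mt; case: no; exists t.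
pose P x := `[< exists2 t, max3 s t & t.1.2 = x >].
have exP : exists x, P x by exists t1.1.2; apply/asboolP; exists t1.
case: (ex_minnP exP) => _ /asboolP[t0 Mt0 <-] min_t0.
have {}min_t0 t : max3 s t -> t0.1.2 <= t.1.2.
  by move=> Mt; apply: min_t0; apply/asboolP; exists t.
have n_gt0 : 0 < n by lia.
apply: (@card_fset_set_le _ _ (fun t => (t.1.2 - t0.1.2) %/ n)) => //.
  move=> [[x y] z] [[x' y'] z']; rewrite !inE => Mt Mt'.
  have [k [/= -> Ez]] := max3_aligned Mt0 Mt (min_t0 _ Mt).
  have [k' [/= -> Ez']] := max3_aligned Mt0 Mt' (min_t0 _ Mt').
  rewrite /len3 /= !addKn !mulnK // => El' El Ek; subst k'.
  by congr (_, _, _); lia.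
move=> t Mt; have [k [E2 E3 El]] := max3_aligned Mt0 Mt (min_t0 _ Mt).
rewrite E2 addKn mulnK //; case: (posnP k) => [->|k_gt0].
  exact: dmax_bound_gt0.
exact: max3_spread Mt k_gt0 E2.
Qed.

(** This excludes a triple longer than the witnesses by [i * g]. If [alpha] is generated,
    [d.-1 * (m * n)] is already less than [a]; otherwise the equation would make [alpha]
    generated. *)
Lemma witness_gap i y : 0 < i -> generated2 m n y ->
  y + i * a <> d.-1 * (m * n).
Proof.
move=> i_gt0 Gy; rewrite /d; case: ifPn => [_|]; first by nia.
rewrite notin_setE /= => gap Ew; have n_gt0 : 0 < n by lia.
apply: (gap); have -> : alpha = y + i.-1 * a by nia.
apply: generated2D => //.
apply: generated2M; have c_gt0 : 0 < c by nia.
have -> : a = m * n - alpha + c.-1 * n * m by nia.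
by apply: generated2D; [apply: generated2_compl | exists (c.-1 * n), 0; ring].
Qed.

Lemma card_max3_witness : exists t,
  d <= #|` fset_set (max3 (val3 a (a + g * m) (a + g * n) t))|.
Proof.
have d_pos := dmax_bound_gt0; have n_gt0 : 0 < n by lia.
(* The second and third coordinates run through the splittings of [k * (m * n)]. Length [k * n] is
   the least that leaves room for all of them, as [j = k] already uses [k * n]. *)
pose k := d.-1; pose f j := (k * n - (j * n + (k - j) * m), j * n, (k - j) * m).
have f_val j : j < d -> len3 (f j) = k * n /\
    val3 a (a + g * m) (a + g * n) (f j) = k * n * a + g * (k * (m * n)).
  move=> lt_jd; have le_jk : j <= k by rewrite /k; lia.
  have El : len3 (f j) = k * n by rewrite /len3 /f /=; nia.
  split=> //; rewrite val3_diff El /=; congr (_ + g * _).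
  by rewrite -{2}(subnK le_jk); ring.
exists (f 0); apply: (@card_fset_set_ge _ _ f).
- by apply: max3_finite; rewrite ?addn_gt0 ?a_gt0.
- by move=> i j [_ /eqP + _]; rewrite eqn_pmul2r // => /eqP.
move=> j lt_jd; have [El Ev] := f_val j lt_jd.
have [_ ->] := f_val 0 d_pos; split=> // t; rewrite El => Et.
rewrite leqNgt; apply/negP => lt_L; move: Et; rewrite val3_diff => Et.
(* At equal values the excess length times [a] is a multiple of [g], so coprimality makes the excess
   itself some [i * g]. *)
have : g %| (len3 t - k * n) * a.
  have -> : (len3 t - k * n) * a =
            g * (k * (m * n)) - g * (t.1.2 * m + t.2 * n) by nia.
  by apply: dvdn_sub; apply: dvdn_mulr.
rewrite Gauss_dvdl // => /dvdnP[i Ei].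
apply: (@witness_gap i (t.1.2 * m + t.2 * n)); first by nia.
  by exists t.1.2, t.2.
apply/eqP; rewrite -(eqn_pmul2l g_gt0); apply/eqP.
have Elt : len3 t = i * g + k * n by lia.
by move: Et; rewrite Elt -/k; nia.
Qed.

End Arithmetic.

(** * From triples to factorizations over the minimal generators *)

Section Transfer.

Variables a1 a2 a3 : nat.
Hypotheses (a1_gt0 : 0 < a1) (lt_a12 : a1 < a2) (lt_a23 : a2 < a3).

Let S := generated3 a1 a2 a3.
Let G := mingens S.
Let a2_gt0 : 0 < a2. Proof. exact: ltn_trans lt_a12. Qed.
Let a3_gt0 : 0 < a3. Proof. exact: ltn_trans lt_a23. Qed.

Lemma generated3P x : S x <-> exists t, val3 a1 a2 a3 t = x.
Proof.
split=> [[x1 [x2 [x3 ->]]]|[[[x1 x2] x3] <-]]; first by exists (x1, x2, x3).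
by exists x1, x2, x3.
Qed.

(** Any of the three integers with a positive coefficient in [b] precedes [b], hence equals it by
    minimality. *)
Lemma mingen_set_sub b : mingen_set S b -> b \in [:: a1; a2; a3].
Proof.
move=> [[x [y [z Eb]]] b_neq0 min_b].
have sub u t : val3 a1 a2 a3 t = u -> u <> 0 -> prec S u b ->
    u \in [:: a1; a2; a3] -> b \in [:: a1; a2; a3].
  move=> Et u_neq0 le_ub uA.
  by rewrite -(min_b u) //; apply/generated3P; exists t.
case: x => [|x] in Eb; last first.
  apply: (sub a1 (1, 0, 0)); rewrite ?inE ?eqxx /val3 /= //; [lia..|].
  by split; [lia | exists x, y, z; lia].
case: y => [|y] in Eb; last first.
  apply: (sub a2 (0, 1, 0)); rewrite ?inE ?eqxx ?orbT /val3 /= //; [lia..|].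
  by split; [lia | exists 0, y, z; lia].
case: z => [|z] in Eb; first by lia.
apply: (sub a3 (0, 0, 1)); rewrite ?inE ?eqxx ?orbT /val3 /= //; [lia..|].
by split; [lia | exists 0, 0, z; lia].
Qed.

Lemma mem_mingens b : b \in G = `[< mingen_set S b >].
Proof.
rewrite /G /mingens mem_sort in_fset_set ?asboolE //.
apply: (@sub_finite_set _ _ [set` [:: a1; a2; a3]]); last exact: finite_seq.
by move=> x /mingen_set_sub.
Qed.

Lemma mingens_uniq : uniq G.
Proof. by rewrite sort_uniq fset_uniq. Qed.

(** Non-minimality splits [x] as [u + (x - u)] with both parts nonzero in [S]; each contributes at
    least one to the length. *)
Lemma non_mingen_decomp x : S x -> x <> 0 -> x \notin G ->
  exists2 t, val3 a1 a2 a3 t = x & 1 < len3 t.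
Proof.
rewrite mem_mingens => Sx x_neq0 /asboolPn not_min.
have [u [Su u_neq0 [le_ux Sxu] u_neqx]] :
    exists u, [/\ S u, u <> 0, prec S u x & u <> x].
  apply: contrapT => no; apply: not_min; split=> // u Su u_neq0 le_u.
  by apply: contrapT => u_neqx; apply: no; exists u.
move/generated3P: Su => [[[x1 x2] x3] Eu].
move/generated3P: Sxu => [[[y1 y2] y3] Exu].
exists (x1 + y1, x2 + y2, x3 + y3); rewrite /val3 /len3 /= in Eu Exu *.
  by rewrite !mulnDl; lia.
have : x1 + x2 + x3 <> 0 by move=> E; apply: u_neq0; nia.
have : y1 + y2 + y3 <> 0 by move=> E; apply: u_neqx; nia.
by lia.
Qed.

Lemma max3_support s t : max3 a1 a2 a3 s t ->
  [/\ a1 \notin G -> t.1.1 = 0, a2 \notin G -> t.1.2 = 0 &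
      a3 \notin G -> t.2 = 0].
Proof.
case: t => [[x y] z] [Es max_t]; rewrite /val3 /len3 /= in Es max_t *.
split.
- have Sa1 : S a1 by exists 1, 0, 0; ring.
  move/(non_mingen_decomp Sa1)=> -[|[[p q] r] Ea]; first by lia.
  rewrite /val3 /len3 /= in Ea * => lt_pqr.
  case: x => // x in Es max_t *.
  by have := max_t (x + p, y + q, z + r); rewrite /= -Es; lia.
- have Sa2 : S a2 by exists 0, 1, 0; ring.
  move/(non_mingen_decomp Sa2)=> -[|[[p q] r] Ea]; first by lia.
  rewrite /val3 /len3 /= in Ea * => lt_pqr.
  case: y => // y in Es max_t *.
  by have := max_t (x + p, y + q, z + r); rewrite /= -Es; lia.
- have Sa3 : S a3 by exists 0, 0, 1; ring.
  move/(non_mingen_decomp Sa3)=> -[|[[p q] r] Ea]; first by lia.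
  rewrite /val3 /len3 /= in Ea * => lt_pqr.
  case: z => // z in Es max_t *.
  by have := max_t (x + p, y + q, z + r); rewrite /= -Es; lia.
Qed.

(** Outside [G] the index is out of range and the default 0 is read. This pads factorizations by
    zeros without a case analysis on which of the three integers are minimal generators. *)
Definition coef (c : (embdim S).-tuple nat) (x : nat) : nat :=
  nth 0 c (index x G).

Definition triple (c : (embdim S).-tuple nat) : nat * nat * nat :=
  (coef c a1, coef c a2, coef c a3).

Lemma coef_notin c x : x \notin G -> coef c x = 0.
Proof.
by rewrite -index_mem -leqNgt => le_G; rewrite /coef nth_default ?size_tuple.
Qed.

(** Used with [F] the identity for values and [F] constantly 1 for lengths. *)
Lemma sum_coef c (F : nat -> nat) :
  \sum_(i < embdim S) tnth c i * F (nth 0 G i) =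
  \sum_(x <- [:: a1; a2; a3]) coef c x * F x.
Proof.
transitivity (\sum_(x <- G) coef c x * F x).
  rewrite (big_nth 0) big_mkord; apply: eq_bigr => i _.
  by rewrite /coef index_uniq ?mingens_uniq // -tnth_nth.
have perm_G : perm_eq G [seq x <- [:: a1; a2; a3] | x \in G].
  apply: uniq_perm; rewrite ?mingens_uniq ?filter_uniq //.
    by rewrite /= !inE; lia.
  move=> x; rewrite mem_filter; case xG: (x \in G) => //=.
  by apply/esym/mingen_set_sub/asboolP; rewrite -mem_mingens.
rewrite (perm_big _ perm_G) big_filter big_mkcond; apply: eq_bigr => x _.
by case: ifPn => // xG; rewrite coef_notin.
Qed.

Lemma val3_triple c :
  val3 a1 a2 a3 (triple c) = \sum_(i < embdim S) tnth c i * nth 0 G i.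
Proof.
by rewrite (sum_coef c id) !big_cons big_nil /val3 /=; ring.
Qed.

Lemma len3_triple c : len3 (triple c) = fact_length c.
Proof.
rewrite /fact_length; under eq_bigr do rewrite -[tnth _ _]muln1.
by rewrite (sum_coef c (fun=> 1)) !big_cons big_nil /len3 /=; ring.
Qed.

Lemma triple_inj : injective triple.
Proof.
move=> c c' [E1 E2 E3]; apply: eq_from_tnth => i.
have iG : nth 0 G i \in G by apply: mem_nth.
have /mingen_set_sub : mingen_set S (nth 0 G i).
  by apply/asboolP; rewrite -mem_mingens.
have coefE (b : (embdim S).-tuple nat) : tnth b i = coef b (nth 0 G i).
  by rewrite /coef index_uniq ?mingens_uniq // -tnth_nth.
by rewrite !coefE !inE => /or3P[] /eqP->.
Qed.

Lemma triple_surj t :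
  (a1 \notin G -> t.1.1 = 0) -> (a2 \notin G -> t.1.2 = 0) ->
  (a3 \notin G -> t.2 = 0) -> exists c, triple c = t.
Proof.
case: t => [[x y] z] /= N1 N2 N3.
pose h b := if b == a1 then x else if b == a2 then y else z.
exists (tcast (size_map h G) (in_tuple (map h G))).
have coefE b : b \in G ->
    coef (tcast (size_map h G) (in_tuple (map h G))) b = h b.
  move=> bG; rewrite /coef val_tcast /= (nth_map 0) ?index_mem //.
  by rewrite nth_index.
have h1 : h a1 = x by rewrite /h eqxx.
have h2 : h a2 = y by rewrite /h gtn_eqF // eqxx.
have h3 : h a3 = z by rewrite /h !gtn_eqF // (ltn_trans lt_a12).
rewrite /triple; congr (_, _, _).
- by case: (boolP (a1 \in G)) => aG; [rewrite coefE | rewrite coef_notin ?N1].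
- by case: (boolP (a2 \in G)) => aG; [rewrite coefE | rewrite coef_notin ?N2].
- by case: (boolP (a3 \in G)) => aG; [rewrite coefE | rewrite coef_notin ?N3].
Qed.

Lemma image_max_factorizations s :
  triple @` max_factorizations S s = max3 a1 a2 a3 s.
Proof.
apply/seteqP; split=> [_ [c [Es max_c] <-]|t Mt].
  (* A competing triple need not come from a factorization, but a longest triple of the same value
     does, by [max3_support]. *)
  split=> [|t /max3_ex[]// t' Mt' le_t]; first by rewrite val3_triple -Es.
  apply: leq_trans le_t _.
  have [N1 N2 N3] := max3_support Mt'; have [c' Ec'] := triple_surj N1 N2 N3.
  rewrite -Ec' !len3_triple; apply: max_c.
  by rewrite /is_factorization -val3_triple Ec'; case: Mt'.
have [N1 N2 N3] := max3_support Mt; have [c Ec] := triple_surj N1 N2 N3.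
exists c => //; case: Mt => Et max_t; split.
  by rewrite /is_factorization -val3_triple Ec.
by move=> c' Ec'; rewrite -!len3_triple Ec; apply: max_t; rewrite val3_triple.
Qed.

Lemma dmax_eltE s : dmax_elt S s = #|` fset_set (max3 a1 a2 a3 s)|.
Proof.
have fin : finite_set (max_factorizations S s).
  apply: (@sub_finite_set _ _ (triple @^-1` max3 a1 a2 a3 s)).
    by move=> c Mc; rewrite -image_max_factorizations; exists c.
  apply: finite_preimage; last exact: max3_finite.
  by move=> c c' _ _; apply: triple_inj.
rewrite -image_max_factorizations fset_set_image // card_imfset //.
exact: triple_inj.
Qed.

End Transfer.

(** * Evaluation of the maximum *)

Lemma dmaxE (S : set nat) d : (forall s, S s -> dmax_elt S s <= d) ->
  (exists2 s, S s & d <= dmax_elt S s) -> dmax S = d.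
Proof.
move=> le_d [s0 Ss0 ge_d]; apply: xget_unique.
  by split=> //; exists s0 => //; apply/eqP; rewrite eqn_leq le_d.
move=> e [[s Ss <-] le_e].
by apply/eqP; rewrite eqn_leq le_d ?(leq_trans ge_d) ?le_e.
Qed.

Local Open Scope ring_scope.

Theorem theorem3p5 (a1 a2 a3 g m n alpha : nat)
    (a1_gt0 : (0 < a1)%N) (lt_a12 : (a1 < a2)%N) (lt_a23 : (a2 < a3)%N)
    (gcd_a : gcdn a1 (gcdn a2 a3) = 1%N)
    (def_g : g = gcdn (a2 - a1) (a3 - a1))
    (def_m : m = ((a2 - a1) %/ g)%N)
    (def_n : n = ((a3 - a1) %/ g)%N)
    (alpha_lt : (alpha < m * n)%N)
    (alpha_mod : (alpha%:Z = - a1%:Z %[mod (m * n)%N%:Z])%Z) :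
  (dmax (generated3 a1 a2 a3))%:Z =
    if alpha \in generated2 m n
    then Num.ceil (a1%:R / (m * n)%:R : rat)
    else Num.ceil (a1%:R / (m * n)%:R : rat) + 1.
Proof.
have g_gt0 : (0 < g)%N by rewrite def_g gcdn_gt0 subn_gt0 lt_a12.
have dvd_g2 : (g %| a2 - a1)%N by rewrite def_g dvdn_gcdl.
have dvd_g3 : (g %| a3 - a1)%N by rewrite def_g dvdn_gcdr.
have Ea2 : a2 = (a1 + g * m)%N by rewrite def_m mulnC divnK // subnKC // ltnW.
have Ea3 : a3 = (a1 + g * n)%N by rewrite def_n mulnC divnK // subnKC //; lia.
have m_gt0 : (0 < m)%N by case: (m) alpha_lt.
have lt_mn : (m < n)%N.
  by rewrite -(ltn_pmul2l g_gt0) -(ltn_add2l a1) -Ea2 -Ea3.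
have cop_mn : coprime m n.
  rewrite /coprime -(eqn_pmul2l g_gt0) muln1 muln_gcdr.
  by rewrite {3}def_g Ea2 Ea3 !addKn.
(* A common divisor of [g] and [a1] also divides [a2] and [a3]. *)
have cop_ga : coprime g a1.
  have dvd_a1 := dvdn_gcdr g a1.
  have dvd_g k : (gcdn g a1 %| g * k)%N := dvdn_mulr k (dvdn_gcdl g a1).
  rewrite /coprime -dvdn1 -gcd_a !dvdn_gcd dvd_a1 Ea2 Ea3.
  by rewrite !(dvdn_addr _ dvd_a1) !dvd_g.
have [c def_c] : exists c, (a1 + alpha = c * (m * n))%N.
  have /eqP := alpha_mod; rewrite eqz_mod_dvd opprK -PoszD => /dvdnP[c Ec].
  by exists c; rewrite addnC.
have mn_gt0 : (0 < m * n)%N := leq_ltn_trans (leq0n _) alpha_lt.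
(* The bounds [0 <= alpha < m * n] place [a1 / (m * n) = c - alpha / (m * n)] in the interval from
   [c - 1], excluded, to [c], included. *)
have -> : Num.ceil (a1%:R / (m * n)%:R : rat) = c%:Z.
  have Ea : a1%:R = c%:R * (m * n)%:R - alpha%:R :> rat.
    by rewrite -natrM -def_c natrD addrK.
  have mn_pos : 0 < (m * n)%:R :> rat by rewrite ltr0n.
  apply: ceil_def; rewrite ltr_pdivlMr // ler_pdivrMr // Ea.
  rewrite intrB mulrBl mul1r lerBlDr lerDl ler0n andbT.
  by rewrite ltrD2l ltrN2 ltr_nat.
have -> : dmax (generated3 a1 a2 a3) =
    (if alpha \in generated2 m n then c else c.+1).
  apply: dmaxE => [s _|].
    by rewrite dmax_eltE // Ea2 Ea3; apply: card_max3_le.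
  have [t le_t] := card_max3_witness a1_gt0 g_gt0 m_gt0 lt_mn cop_mn cop_ga
    alpha_lt def_c.
  exists (val3 a1 (a1 + g * m) (a1 + g * n) t).
    by rewrite Ea2 Ea3; apply/generated3P; exists t.
  by rewrite dmax_eltE // {1}Ea2 {1}Ea3.
by case: ifP => _ //; rewrite -PoszD addn1.
Qed.
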